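(* Let $G=(V,E)$ be a finite undirected unweighted graph with $|E|\ge 1$, let $Q\subseteq V$ be a nonempty set of query nodes, let $\mathcal{P}$ be a community constraint (a property of node sets of $G$), and let $H\subseteq V$ be an identified community that satisfies $\mathcal{P}$ and contains $Q$, with $CM(H)>0$ (equivalently $DM(H)>0$). If the density modularity $DM$ suffers from the resolution limit problem (for $G,Q,\mathcal{P},H$), then the classic modularity $CM$ suffers from the resolution limit problem (for the same $G,Q,\mathcal{P},H$) as well.
   Context: For a nonempty set $C\subseteq V$, let $l_C$ be the number of edges of $G$ with both endpoints in $C$, and let $d_C$ be the sum of the degrees in $G$ of the nodes of $C$. The classic modularity and the density modularity of $C$ are $$CM(C)=\frac{1}{2|E|}\left(2l_C-\frac{d_C^2}{2|E|}\right),\qquad DM(C)=\frac{1}{2|C|}\left(2l_C-\frac{d_C^2}{2|E|}\right).$$ Resolution limit problem (for community search): given $G$, query nodes $Q$, an objective function $f$ on node sets, a community constraint $\mathcal{P}$, and an identified subgraph (node set) $H$ satisfying $\mathcal{P}$ and containing all nodes of $Q$, the objective function $f$ suffers from the resolution limit problem if there is a subgraph (nonempty node set) $H'$ satisfying $\mathcal{P}$ such that $H\cap H'=\varnothing$, the induced subgraph $G[H\cup H']$ is connected, $H\cup H'$ satisfies $\mathcal{P}$, and $f(H\cup H')\ge f(H)$. *)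

(* Defs.v *)
From mathcomp Require Import all_boot all_order all_algebra.
Set Implicit Arguments.
Unset Strict Implicit.
Unset Printing Implicit Defensive.
Import Order.TTheory GRing.Theory Num.Theory.
Local Open Scope ring_scope.

Record sgraph := SGraph {
  node :> finType;
  adj : rel node;
  adj_sym : symmetric adj;
  adj_irrefl : irreflexive adj }.

Section Modularity.
Variable G : sgraph.
Implicit Types (C H : {set G}) (x y : G).

Definition edges : {set {set G}} :=
  [set a | [exists x, exists y, adj x y && (a == [set x; y])]].

Definition degree x : nat := #|[set y | adj x y]|.

Definition inner_edges C : nat := #|[set a in edges | a \subset C]|.

(* Degrees are taken in G, not in the subgraph induced by C. *)
Definition total_degree C : nat := (\sum_(x in C) degree x)%N.

Definition induced_adj C : rel G :=
  [rel x y | [&& x \in C, y \in C & adj x y]].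

Definition induced_connected C : Prop :=
  C != set0 /\ {in C &, forall x y, connect (induced_adj C) x y}.

(* Meaningful when C is nonempty and G has an edge; otherwise x / 0 = 0. *)
Definition classic_modularity (R : realFieldType) C : R :=
  1 / (2 * #|edges|%:R) *
  (2 * (inner_edges C)%:R - (total_degree C)%:R ^+ 2 / (2 * #|edges|%:R)).

Definition density_modularity (R : realFieldType) C : R :=
  1 / (2 * #|C|%:R) *
  (2 * (inner_edges C)%:R - (total_degree C)%:R ^+ 2 / (2 * #|edges|%:R)).

(* The first two conjuncts record what is presupposed of the identified
   community H. *)
Definition resolution_limit (R : realFieldType) (Q : {set G})
    (P : {set G} -> Prop) (H : {set G}) (f : {set G} -> R) : Prop :=
  [/\ P H, Q \subset H &
    exists H' : {set G},
      [/\ H' != set0 /\ P H', [disjoint H & H'],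
          induced_connected (H :|: H'), P (H :|: H') &
          f H <= f (H :|: H')]].

End Modularity.

(* Main.v *)
(* Both modularities are positive multiples of the same quantity
   m(C) = 2 l_C - d_C^2 / (2|E|): by 1/(2|E|), which is constant, and by
   1/(2|C|), which decreases as C grows.  So if m(H) > 0 and
   DM(H) <= DM(H u H'), then m(H u H') >= m(H) |H u H'| / |H| >= m(H). *)
Require Import Defs.
From mathcomp Require Import all_boot all_order all_algebra.
Import Order.TTheory GRing.Theory Num.Theory.
Local Open Scope ring_scope.

(** Since [x] is nonnegative, [b * x <= a * x <= b * y], and [b] cancels. Here [a] and [b] stand for
    the factors 1/(2|C|) and 1/(2|D|) of the density modularity. *)
Lemma le_of_scaled_le (R : realFieldType) (a b x y : R) :
  0 < b -> b <= a -> 0 <= x -> a * x <= b * y -> x <= y.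
Proof.
move=> b0 ba x0 le_ax_by; rewrite -(ler_pM2l b0).
by apply: le_trans le_ax_by; rewrite ler_wpM2r.
Qed.

Lemma classic_le_of_density_le (R : realFieldType) (G : sgraph)
    (C D : {set G}) :
  C != set0 -> C \subset D -> 0 < classic_modularity R C ->
  density_modularity R C <= density_modularity R D ->
  classic_modularity R C <= classic_modularity R D.
Proof.
rewrite -card_gt0 /classic_modularity /density_modularity !div1r.
move=> C0 /subset_leq_card leCD.
have D0 := leq_trans C0 leCD.
have e0 : 0 <= (2 * #|edges G|%:R : R)^-1 by rewrite invr_ge0 -natrM ler0n.
move=> CMpos leDM; apply: (ler_wpM2l e0).
apply: le_of_scaled_le leDM.
- by rewrite invr_gt0 -natrM ltr0n muln_gt0.
- by rewrite lef_pV2 ?posrE -?natrM ?ltr0n ?muln_gt0 // ler_nat leq_mul2l.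
(* A negative m(C) would make the classic modularity of [C] nonpositive, against [CMpos]. *)
- rewrite leNgt; apply/negP => /ltW mneg.
  by move: CMpos; rewrite ltNge mulr_ge0_le0.
Qed.

Theorem lemma2 (R : realFieldType) (G : sgraph) (Q : {set G})
    (P : {set G} -> Prop) (H : {set G})
    (hE : (1 <= #|edges G|)%N) (hQ : Q != set0)
    (hPH : P H) (hQH : Q \subset H)
    (hCM : 0 < classic_modularity R H) :
  resolution_limit Q P H (@density_modularity G R) ->
  resolution_limit Q P H (@classic_modularity G R).
Proof.
case=> _ _ [H' [hH' disj conn hPU leDM]]; split=> //.
exists H'; split=> //; apply: classic_le_of_density_le => //.
(* [H] is nonempty because it contains the nonempty [Q]. *)
- by apply: contraNneq hQ => H0; rewrite -subset0 -H0.
- exact: subsetUl.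
Qed.
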